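(* Let $G$ be a finite commutative group with $|G|=q$, and let $A_1,A_2\subset G$ be standard sets. Then \[ \overline\delta(A_1\cap A_2)\le q\,\overline\delta(A_1)\,\overline\delta(A_2). \]
   Context: $G$ is written additively. A set $A\subset G$ is a standard set if $A=-A$ and $0\in A$. For a standard set $A$, $\overline\Delta(A)=\max\{|B|:B\subset G,\ B-B\subset A\}$ and $\overline\delta(A)=1/\overline\Delta(A)$. *)

(* Defs.v *)
From HB Require Import structures.
From mathcomp Require Import all_boot all_order all_algebra.
Set Implicit Arguments.
Unset Strict Implicit.
Unset Printing Implicit Defensive.
Import GRing.Theory.
Local Open Scope ring_scope.

Definition oppset (G : finZmodType) (A : {set G}) : {set G} :=
  [set - x | x in A].

Definition diffset (G : finZmodType) (A B : {set G}) : {set G} :=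
  [set x - y | x in A, y in B].

Definition standard (G : finZmodType) (A : {set G}) : Prop :=
  A = oppset A /\ 0 \in A.

Definition Delta_bar (G : finZmodType) (A : {set G}) : nat :=
  \max_(B : {set G} | diffset B B \subset A) #|B|.

Definition delta_bar (G : finZmodType) (A : {set G}) : rat :=
  1 / (Delta_bar A)%:R.

(* Main.v *)
(** Double counting: for optimal [B1] and [B2], the sets [B1 :&: (B2 + t)]
    have average size [#|B1| * #|B2| / q] over the translations [t], and the
    differences of each of them lie in both [A1] and [A2]. *)
Require Import Defs.
From HB Require Import structures.
From mathcomp Require Import all_boot all_order all_algebra.
Import Order.TTheory GRing.Theory Num.Theory.
Local Open Scope ring_scope.

Lemma diffset_subP (G : finZmodType) (A B : {set G}) :
  reflect {in B &, forall x y, x - y \in A} (diffset B B \subset A).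
Proof.
apply: (iffP subsetP) => [sBA x y Bx By | BA _ /imset2P[x y Bx By ->]].
  by apply: sBA; apply: imset2_f.
exact: BA.
Qed.

Lemma leq_Delta_bar (G : finZmodType) (A B : {set G}) :
  {in B &, forall x y, x - y \in A} -> (#|B| <= Delta_bar A)%N.
Proof.
move=> /diffset_subP sBA.
exact: (@leq_bigmax_cond _ (fun B : {set G} => diffset B B \subset A)
  (fun B : {set G} => #|B|) B sBA).
Qed.

Lemma Delta_bar_attained (G : finZmodType) (A : {set G}) :
  exists2 B : {set G},
    {in B &, forall x y, x - y \in A} & Delta_bar A = #|B|.
Proof.
have [|B /diffset_subP sBA maxB] := @eq_bigmax_cond {set G}
  (fun B => diffset B B \subset A) (fun B => #|B|); last by exists B.
(* The empty set is admissible, so the maximum runs over a nonempty family and is attained. *)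
apply/card_gt0P; exists set0; apply/diffset_subP => x y.
by rewrite inE.
Qed.

(** The singleton of [0] is admissible. Positivity is what later permits clearing denominators,
    since [1 / 0] is [0] in [rat]. *)
Lemma Delta_bar_gt0 (G : finZmodType) (A : {set G}) :
  0 \in A -> (0 < Delta_bar A)%N.
Proof.
move=> A0; rewrite -(cards1 (0 : G)); apply: leq_Delta_bar => x y.
by rewrite !inE => /eqP-> /eqP->; rewrite subrr.
Qed.

(** Swap the sums: for fixed [x], the map sending [t] to [x - t] permutes [G], so exactly [#|B2|]
    values of [t] place [x - t] in [B2]. *)
Lemma sum_card_translate (G : finZmodType) (B1 B2 : {set G}) :
  (\sum_(t : G) #|[set x in B1 | (x - t)%R \in B2]| = #|B1| * #|B2|)%N.
Proof.
transitivity (\sum_(t : G) \sum_(x in B1) ((x - t)%R \in B2 : nat))%N.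
  apply: eq_bigr => t _; rewrite -sum1_card -big_mkcondr.
  by apply: eq_bigl => x; rewrite inE.
rewrite exchange_big -sum_nat_const; apply: eq_bigr => x _ /=.
rewrite (reindex_inj (subrI x)) -sum1_card [RHS]big_mkcond /=.
by apply: eq_bigr => t _; rewrite subKr; case: (_ \in _).
Qed.

Lemma Delta_barI (G : finZmodType) (A1 A2 : {set G}) :
  (Delta_bar A1 * Delta_bar A2 <= #|G| * Delta_bar (A1 :&: A2))%N.
Proof.
have [B1 BA1 ->] := Delta_bar_attained _ A1.
have [B2 BA2 ->] := Delta_bar_attained _ A2.
(* Both sides become sums over [t], compared term by term, so no best translation has to be
   chosen. *)
rewrite -sum_card_translate -sum_nat_const; apply: leq_sum => t _.
apply: leq_Delta_bar => x y; rewrite !inE => /andP[B1x B2x] /andP[B1y B2y].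
(* Differences are translation invariant: the shifted form gives membership in [A2], the unshifted
   one in [A1]. *)
have -> : x - y = (x - t) - (y - t) by rewrite opprB addrA subrK.
by rewrite BA2 // opprB addrA subrK BA1.
Qed.

Theorem theorem6p1 (G : finZmodType) (q : nat) (hq : #|G| = q)
  (A1 A2 : {set G}) (hA1 : standard A1) (hA2 : standard A2) :
  delta_bar (A1 :&: A2) <= q%:R * delta_bar A1 * delta_bar A2.
Proof.
have [[_ A1_0] [_ A2_0]] := (hA1, hA2).
(* Multiplying out the positive denominators leaves the integer inequality [Delta_barI]. *)
rewrite /delta_bar !mul1r -mulrA -invfM ler_pdivlMr; last first.
  by rewrite -natrM ltr0n muln_gt0 !Delta_bar_gt0.
rewrite mulrC ler_pdivrMr; last by rewrite ltr0n Delta_bar_gt0 // inE A1_0.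
by rewrite -!natrM ler_nat -hq Delta_barI.
Qed.
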